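(* Let $r\geq 3$ be an integer and let $M$ be a matroid of rank $r$, on a finite or infinite ground set, that has two hyperplanes $H$ and $H'$ with $H\cap H'=\emptyset$. Then $M$ is not sticky.
   Context: Matroids may have finite or infinite ground sets; all matroids considered have finite rank. $E(M)$ denotes the ground set of $M$. A hyperplane of a rank-$r$ matroid is a flat of rank $r-1$. Given matroids $N$ and $N'$ whose restrictions to $E(N)\cap E(N')$ are equal, an amalgam of $N$ and $N'$ is a matroid on $E(N)\cup E(N')$ having both $N$ and $N'$ as restrictions. A matroid $M$ is sticky if, whenever $N$ and $N'$ are matroids whose restrictions to $E(N)\cap E(N')$ are equal to each other and isomorphic to $M$, the matroids $N$ and $N'$ have an amalgam. *)

(* Defs.v *)
From mathcomp Require Import all_boot.
From mathcomp Require Import boolp classical_sets functions cardinality.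

Set Implicit Arguments.
Unset Strict Implicit.
Unset Printing Implicit Defensive.

Local Open Scope classical_set_scope.
Local Open Scope card_scope.

(* A matroid of finite rank, given by its independent sets.  The ground set is
   an arbitrary subset of the carrier [T], so that matroids with overlapping
   ground sets can be compared.  [indep_bound] makes all independent sets
   finite, so [~~ (J #<= I)] in [indep_aug] means |I| < |J|. *)
Record matroid (T : Type) := Matroid {
  ground : set T;
  indep : set (set T);
  indep_ground : forall I, indep I -> I `<=` ground;
  indep0 : indep set0;
  indep_subset : forall I J, I `<=` J -> indep J -> indep I;
  indep_aug : forall I J, indep I -> indep J -> ~~ (J #<= I) ->
    exists x, [/\ J x, ~ I x & indep (x |` I)];
  indep_bound : exists k, forall I, indep I -> I #<= `I_k
}.

Lemma matroid_ext (T : Type) (M N : matroid T) :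
  ground M = ground N -> indep M = indep N -> M = N.
Proof.
case: M N => gM iM a b c d e [gN iN a' b' c' d' e'] /= gE iE.
by subst; congr Matroid; exact: Prop_irrelevance.
Qed.

Section MatroidNotions.
Variables (T : Type) (M : matroid T).
Implicit Types A F H : set T.

Definition is_rank A (n : nat) : Prop :=
  (exists I, [/\ I `<=` A, indep M I & I #= `I_n]) /\
  (forall I, I `<=` A -> indep M I -> I #<= `I_n).

Definition rank A : nat := xget 0 (is_rank A).

Lemma rankP A : is_rank A (rank A).
Proof.
apply: xgetPex.
pose P n := `[< exists I, [/\ I `<=` A, indep M I & I #= `I_n] >].
have exP : exists n, P n.
  exists 0; apply/asboolP; exists set0; split; [exact: sub0set|exact: indep0|].
  by rewrite II0 card_eq00.
have [k kP] := indep_bound M.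
have ubP n : P n -> n <= k.
  move=> /asboolP[I [_ /kP Ik In]].
  by rewrite -card_le_II -(card_le_eql In).
exists (ex_maxn exP ubP); case: ex_maxnP => n /asboolP nP nmax; split => // I IA iI.
have /finite_setP[m Im] : finite_set I.
  exact: card_le_finite (kP _ iI) (finite_II k).
by rewrite (card_le_eql Im) card_le_II nmax//; apply/asboolP; exists I.
Qed.

Definition flat F : Prop :=
  F `<=` ground M /\
  forall x, ground M x -> ~ F x -> rank F < rank (x |` F).

Definition hyperplane H : Prop := flat H /\ (rank H).+1 = rank (ground M).

End MatroidNotions.

Section Restriction.
Variables (T : Type) (M : matroid T) (X : set T).

Let rindep : set (set T) := [set I | indep M I /\ I `<=` X].

Let rindep_ground I : rindep I -> I `<=` ground M `&` X.
Proof. by case=> /indep_ground IM IX x Ix; split; [exact: IM|exact: IX]. Qed.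

Let rindep0 : rindep set0.
Proof. by split; [exact: indep0|exact: sub0set]. Qed.

Let rindep_subset I J : I `<=` J -> rindep J -> rindep I.
Proof.
by move=> IJ [iJ JX]; split; [exact: indep_subset IJ iJ|exact: subset_trans JX].
Qed.

Let rindep_aug I J : rindep I -> rindep J -> ~~ (J #<= I) ->
  exists x, [/\ J x, ~ I x & rindep (x |` I)].
Proof.
move=> [iI IX] [iJ JX] /(indep_aug iI iJ)[x [Jx Ix ixI]].
exists x; split => //; split => // y [->|]; [exact: JX|exact: IX].
Qed.

Let rindep_bound : exists k, forall I, rindep I -> I #<= `I_k.
Proof. by have [k kP] := indep_bound M; exists k => I [/kP]. Qed.

Definition restriction : matroid T :=
  Matroid rindep_ground rindep0 rindep_subset rindep_aug rindep_bound.

End Restriction.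

(* The bijection is between the ground sets seen as types, since the carriers
   [T] and [U] may differ outside them. *)
Definition isomorphic (T U : Type) (M : matroid T) (N : matroid U) : Prop :=
  exists2 f : ground M -> ground N, bijective f &
    forall I : set (ground M),
      indep M (val @` I) <-> indep N (val @` (f @` I)).

Definition amalgam (T : Type) (N N' A : matroid T) : Prop :=
  [/\ ground A = ground N `|` ground N',
      restriction A (ground N) = N &
      restriction A (ground N') = N'].

Definition sticky (T : Type) (M : matroid T) : Prop :=
  forall (U : Type) (N N' : matroid U),
    let X := ground N `&` ground N' in
    restriction N X = restriction N' X ->
    isomorphic (restriction N X) M ->
    exists A : matroid U, amalgam N N' A.

(* Main.v *)
Require Import Defs.
From mathcomp Require Import all_boot.
From mathcomp Require Import finmap zify.
From mathcomp Require Import boolp classical_sets functions cardinality.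

Set Implicit Arguments.
Unset Strict Implicit.
Unset Printing Implicit Defensive.

Local Open Scope classical_set_scope.
Local Open Scope card_scope.

(** Both extensions come from one construction: add a finite set of free points
    to [M], truncate to rank [k], and lower the rank of some flats below [k].
    This yields a matroid as soon as any two of these flats meet in rank at most
    [k - 2].
    - [N] has rank [r] and a set [P] of [r - 2] new points, the flats being
      [H + P] and [H' + P]; thus [P] lies in the closures of [H] and of [H'].
    - [N'] has rank [r + 1] and disjoint sets [A] and [B] of [r - 1] new points,
      the flats being [H + A], [H + B], [H' + A], [H' + B].
    In an amalgam, [H + A + P] and [H' + A + P] have rank at most [r] and their
    union has rank [r + 1], so submodularity bounds the rank of [A + P] by
    [r - 1]; likewise for [B + P].  As [P] has rank [r - 2], a last use of
    submodularity gives [A + B] rank at most [r], not [r + 1] as in [N'].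
    For [r = 3], two points from each of [H], [H'], [A], [B] form the Vamos
    matroid in [N']. *)

(** * Cardinalities of finite sets as natural numbers *)

Section FiniteCardinal.
Variable T : Type.
Implicit Types A B : set T.

(* [{classic T}] is [T] with a choice structure, as [fset_set] requires; the
   junk value on infinite sets is [0]. *)
Definition ncard A : nat := #|` fset_set (A : set {classic T})|.

Lemma ncardP A : finite_set A -> A #= `I_(ncard A).
Proof.
case/finite_setP => n An; suff -> : ncard A = n by [].
exact: (@card_fset_set {classic T}).
Qed.

Lemma ncard_eq A n : A #= `I_n -> ncard A = n.
Proof. exact: (@card_fset_set {classic T}). Qed.

Lemma ncard0 : ncard set0 = 0.
Proof. by rewrite /ncard fset_set0 cardfs0. Qed.

Lemma ncard_gt0 A : 0 < ncard A -> A !=set0.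
Proof. by move=> A0; apply/set0P/eqP => AE; move: A0; rewrite AE ncard0. Qed.

Lemma ncard_le A B : finite_set A -> finite_set B ->
  (A #<= B) = (ncard A <= ncard B).
Proof.
move=> /ncardP fA /ncardP fB.
by rewrite (card_le_eql fA) (card_le_eqr fB) card_le_II.
Qed.

Lemma ncard_leI A n : finite_set A -> (A #<= `I_n) = (ncard A <= n).
Proof. by move=> /ncardP fA; rewrite (card_le_eql fA) card_le_II. Qed.

Lemma ncardS A B : A `<=` B -> finite_set B -> ncard A <= ncard B.
Proof.
move=> AB fB; have fA := sub_finite_set AB fB.
by rewrite -ncard_le//; exact: subset_card_le.
Qed.

Lemma ncardUI A B : finite_set A -> finite_set B ->
  ncard (A `|` B) + ncard (A `&` B) = ncard A + ncard B.
Proof.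
move=> fA fB; rewrite /ncard (@fset_setU {classic T})//
  (@fset_setI {classic T})//.
exact: cardfsUI.
Qed.

Lemma ncardU1 x A : finite_set A -> ~ A x -> ncard (x |` A) = (ncard A).+1.
Proof.
move=> fA Ax; have := ncardUI (finite_set1 x) fA.
have -> : [set x] `&` A = set0 by apply/disjoints_subset => y -> /Ax.
by rewrite ncard0 addn0 => ->; rewrite /ncard (@fset_set1 {classic T}) cardfs1.
Qed.

Lemma ncard_eqS A B : A `<=` B -> finite_set B -> ncard B <= ncard A -> A = B.
Proof.
move=> AB fB BA; apply/seteqP; split => // x Bx; apply: contrapT => Ax.
have fA := sub_finite_set AB fB.
have xAB : x |` A `<=` B by move=> y [->|/AB].
by have := ncardS xAB fB; rewrite ncardU1//; lia.
Qed.

Lemma ncard_subset A n : finite_set A -> n <= ncard A ->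
  exists B, [/\ B `<=` A, finite_set B & ncard B = n].
Proof.
move=> fA; elim: n => [|n IH] nA.
  by exists set0; split; [exact: sub0set|exact: finite_set0|exact: ncard0].
have [B [BA fB Bn]] := IH (ltnW nA).
have [x [Ax Bx]] : exists x, A x /\ ~ B x.
  apply: contrapT => nx; suff : ncard A <= ncard B by rewrite Bn leqNgt nA.
  apply: ncardS => // x Ax; apply: contrapT => Bx; apply: nx; by exists x.
exists (x |` B); split; [by move=> y [->|/BA]| |by rewrite ncardU1// Bn].
by rewrite finite_setU; split => //; exact: finite_set1.
Qed.

End FiniteCardinal.

(** * Sets of old and new points in a disjoint sum *)

Section SumCardinal.
Variables T W : Type.

Definition lpart (I : set (T + W)) : set T := [set t | I (inl t)].
Definition rpart (I : set (T + W)) : set W := [set w | I (inr w)].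
(** This is the [X + Y] of the informal argument: [T] carries the points of [M], [W] the new
    ones. *)
Definition sumset (X : set T) (Y : set W) : set (T + W) :=
  [set u | match u with inl t => X t | inr w => Y w end].

Lemma ncard_image (U V : Type) (f : U -> V) (A : set U) :
  injective f -> finite_set A -> ncard (f @` A) = ncard A.
Proof.
move=> finj /ncardP fA; apply: ncard_eq; apply: card_eq_trans fA.
by apply: inj_card_eq => x y _ _; exact: finj.
Qed.

Lemma sumsetE X Y : sumset X Y = (inl @` X) `|` (inr @` Y).
Proof.
apply/seteqP; split => [[x|x] xX|_ [[x xX <-]|[x xX <-]]] //.
- by left; exists x.
- by right; exists x.
Qed.

Lemma sumset_parts I : sumset (lpart I) (rpart I) = I.
Proof. by apply/seteqP; split => [] []. Qed.

Lemma finite_sumset X Y :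
  finite_set X -> finite_set Y -> finite_set (sumset X Y).
Proof.
by move=> fX fY; rewrite sumsetE finite_setU; split; exact: finite_image.
Qed.

Lemma ncard_sumset X Y : finite_set X -> finite_set Y ->
  ncard (sumset X Y) = ncard X + ncard Y.
Proof.
move=> fX fY; rewrite sumsetE.
have := ncardUI (finite_image inl fX) (finite_image inr fY).
have -> : (@inl T W @` X) `&` (inr @` Y) = set0.
  by apply/disjoints_subset => _ [x _ <-] [].
rewrite ncard0 addn0 => ->.
by congr addn; rewrite ncard_image// => ? ? [].
Qed.

Lemma finite_lpart I : finite_set I -> finite_set (lpart I).
Proof.
move=> fI; have eqI : @inl T W @` lpart I #= lpart I.
  by apply: inj_card_eq => x y _ _ [].
by rewrite -(eq_finite_set eqI); apply: sub_finite_set fI => _ [x Ix <-].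
Qed.

Lemma finite_rpart I : finite_set I -> finite_set (rpart I).
Proof.
move=> fI; have eqI : @inr T W @` rpart I #= rpart I.
  by apply: inj_card_eq => x y _ _ [].
by rewrite -(eq_finite_set eqI); apply: sub_finite_set fI => _ [x Ix <-].
Qed.

Lemma ncard_parts I : finite_set I ->
  ncard I = ncard (lpart I) + ncard (rpart I).
Proof.
move=> fI; rewrite -ncard_sumset ?sumset_parts//; [exact: finite_lpart|].
exact: finite_rpart.
Qed.

Lemma lpartU1l t I : lpart (inl t |` I) = t |` lpart I.
Proof.
apply/seteqP; split => x /= [].
- by case=> ->; left.
- by right.
- by move=> ->; left.
- by right.
Qed.

Lemma lpartU1r w I : lpart (inr w |` I) = lpart I.
Proof. by apply/seteqP; split => x /= => [[]|]//; right. Qed.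

Lemma sumsetU X X' Y Y' :
  sumset X Y `|` sumset X' Y' = sumset (X `|` X') (Y `|` Y').
Proof. by apply/seteqP; split => [] [x|x]. Qed.

Lemma sumsetI X X' Y Y' :
  sumset X Y `&` sumset X' Y' = sumset (X `&` X') (Y `&` Y').
Proof. by apply/seteqP; split => [] [x|x]. Qed.

Lemma sumsetS X X' Y Y' :
  X `<=` X' -> Y `<=` Y' -> sumset X Y `<=` sumset X' Y'.
Proof. by move=> XX' YY' [x /XX'|x /YY']. Qed.

End SumCardinal.

(** * Bases, submodularity of the rank, and flats *)

Section Rank.
Variables (T : Type) (M : matroid T).
Implicit Types X Y I J H : set T.

Lemma indep_finite I : indep M I -> finite_set I.
Proof.
by have [k kP] := indep_bound M => /kP/card_le_finite; apply; exact: finite_II.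
Qed.

Lemma indep_ncard_aug I J : indep M I -> indep M J -> ncard I < ncard J ->
  exists x, [/\ J x, ~ I x & indep M (x |` I)].
Proof.
move=> iI iJ IJ; apply: indep_aug => //.
by rewrite ncard_le -?ltnNge//; exact: indep_finite.
Qed.

Lemma rank_ge X I : I `<=` X -> indep M I -> ncard I <= rank M X.
Proof.
move=> IX iI; have [_ /(_ I IX iI)] := rankP M X.
by rewrite ncard_leI//; exact: indep_finite.
Qed.

Lemma rank_basis X : exists I, [/\ I `<=` X, indep M I & ncard I = rank M X].
Proof. by have [[I [IX iI /ncard_eq In]] _] := rankP M X; exists I. Qed.

Lemma rank_le X n : (forall I, I `<=` X -> indep M I -> ncard I <= n) ->
  rank M X <= n.
Proof. by move=> Xn; have [I [IX iI <-]] := rank_basis X; exact: Xn. Qed.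

Lemma rankS X Y : X `<=` Y -> rank M X <= rank M Y.
Proof.
by move=> XY; apply: rank_le => I IX; apply: rank_ge; exact: subset_trans XY.
Qed.

Lemma basis_extend X I : I `<=` X -> indep M I ->
  exists J, [/\ I `<=` J, J `<=` X, indep M J & ncard J = rank M X].
Proof.
move=> IX iI; have [n] := ubnP (rank M X - ncard I).
elim: n I IX iI => // n IH I IX iI In.
have [IrX|rXI] := ltnP (ncard I) (rank M X); last first.
  by exists I; split=> //; apply/eqP; rewrite eqn_leq rXI rank_ge.
have [K [KX iK Kr]] := rank_basis X.
have [|x [Kx Ix ixI]] := indep_ncard_aug iI iK; first by rewrite Kr.
have [|//||J [xIJ JX iJ Jr]] := IH (x |` I).
- by move=> y [->|/IX//]; exact: KX.
- by rewrite ncardU1//; [lia|exact: indep_finite].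
by exists J; split => //; apply: subset_trans xIJ; right.
Qed.

(** Extend a basis [I] of the intersection to a basis [J] of the union: the traces of [J] on [X] and
    [Y] are independent, have union [J], and both contain [I]. *)
Lemma rank_submod X Y :
  rank M (X `|` Y) + rank M (X `&` Y) <= rank M X + rank M Y.
Proof.
have [I [IXY iI <-]] := rank_basis (X `&` Y).
have IXuY : I `<=` X `|` Y by move=> x /IXY[]; left.
have [J [IJ JXY iJ <-]] := basis_extend IXuY iI.
have fJ := indep_finite iJ.
have iJX : indep M (J `&` X) by apply: indep_subset iJ => x [].
have iJY : indep M (J `&` Y) by apply: indep_subset iJ => x [].
have JXr : ncard (J `&` X) <= rank M X by apply: rank_ge => // x [].
have JYr : ncard (J `&` Y) <= rank M Y by apply: rank_ge => // x [].
have := ncardUI (indep_finite iJX) (indep_finite iJY).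
have -> : (J `&` X) `|` (J `&` Y) = J.
  by rewrite -setIUr; apply: setIidl.
have : ncard I <= ncard ((J `&` X) `&` (J `&` Y)).
  apply: ncardS; last by apply: finite_setIl; exact: indep_finite.
  by move=> x Ix; have [] := IXY x Ix; split; split => //; exact: IJ.
lia.
Qed.

Lemma flat_indepU1 H I x : flat M H -> I `<=` H -> indep M I ->
  ground M x -> ~ H x -> indep M (x |` I).
Proof.
move=> [HM flatH] IH iI Mx Hx; have [J [IJ JH iJ Jr]] := basis_extend IH iI.
have [K [KxH iK Kr]] := rank_basis (x |` H).
have [|y [Ky Jy iyJ]] := indep_ncard_aug iJ iK; first by rewrite Jr Kr flatH.
have [yx|Hy] := KxH y Ky.
  by apply: indep_subset iyJ => z [->|/IJ]; [left|right].
(* A point [y] of [H] would enlarge the basis [J] of [H], so [J] can only be augmented by [x]. *)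
have : ncard (y |` J) <= rank M H by apply: rank_ge => // z [->|/JH].
by rewrite ncardU1//; [lia|exact: indep_finite].
Qed.

End Rank.

(** * Truncation combined with lowering the rank of chosen flats *)

Section Collapse.
Variables (U : Type) (M : matroid U) (k : nat) (F : set (set U)).
Hypothesis k0 : 0 < k.
(** Flatness of the members of [F], in the form that augmentation consumes. *)
Hypothesis F_closed : forall Z I x, F Z -> I `<=` Z -> indep M I ->
  ground M x -> ~ Z x -> indep M (x |` I).
Hypothesis F_meet : forall Z Z' I, F Z -> F Z' -> Z <> Z' -> I `<=` Z ->
  I `<=` Z' -> indep M I -> (ncard I).+1 < k.

Let cindep : set (set U) := [set I | [/\ indep M I, ncard I <= k &
  forall Z, F Z -> I `<=` Z -> ncard I < k]].

Let cindep_ground I : cindep I -> I `<=` ground M.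
Proof. by case=> /indep_ground. Qed.

Let cindep0 : cindep set0.
Proof. by split => //; rewrite ?ncard0//; exact: indep0. Qed.

Let cindep_subset I J : I `<=` J -> cindep J -> cindep I.
Proof.
move=> IJ [iJ Jk JF]; have fJ := indep_finite iJ; have IJn := ncardS IJ fJ.
split; [exact: indep_subset iJ|exact: leq_trans Jk|move=> Z FZ IZ].
(* If [I] had [k] elements it would be all of [J], and [J] already obeys the strict bound in [Z]. *)
rewrite ltnNge; apply/negP => kI.
have IJE : I = J by apply: ncard_eqS => //; lia.
by have := JF Z FZ; rewrite -IJE => /(_ IZ); lia.
Qed.

(* The case at stake is [ncard I = k.-1] with [I] inside some [Z]: [Z] is then
   unique by [F_meet], and [J] cannot lie in [Z]. *)
Let cindep_aug I J : cindep I -> cindep J -> ~~ (J #<= I) ->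
  exists x, [/\ J x, ~ I x & cindep (x |` I)].
Proof.
move=> [iI Ik IF] [iJ Jk JF] JI.
have fI := indep_finite iI; have fJ := indep_finite iJ.
have {}JI : ncard I < ncard J by move: JI; rewrite ncard_le// -ltnNge.
have [[Z [FZ [IZ Ik1]]]|nZ] :=
    pselect (exists Z, F Z /\ (I `<=` Z /\ (ncard I).+1 = k)).
  have [x [Jx Zx]] : exists x, J x /\ ~ Z x.
    apply: contrapT => nx.
    have /(JF Z FZ) : J `<=` Z.
      by move=> x Jx; apply: contrapT => Zx; apply: nx; exists x.
    by lia.
  have Ix : ~ I x by move=> /IZ.
  exists x; split=> //; split.
  - by apply: F_closed iI _ Zx => //; exact: indep_ground iJ _ Jx.
  - by rewrite ncardU1// Ik1.
  - move=> Z' FZ' xIZ'; have IZ' : I `<=` Z' by move=> y Iy; apply: xIZ'; right.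
    have ZZ' : Z <> Z' by move=> ZZ'; apply: Zx; rewrite ZZ'; apply: xIZ'; left.
    by have := F_meet FZ FZ' ZZ' IZ IZ' iI; rewrite Ik1 ltnn.
(* Now any augmentation in [M] will do: a [k]-element result inside some [Z] would put [I], of size
   [k - 1], in the case just treated. *)
have [x [Jx Ix ixI]] := indep_ncard_aug iI iJ JI.
exists x; split=> //; split=> //; rewrite ncardU1//; first exact: leq_trans Jk.
move=> Z FZ xIZ; rewrite ltn_neqAle (leq_trans JI)// andbT.
apply/eqP => Ik1; apply: nZ; exists Z; split => //; split => // y Iy.
by apply: xIZ; right.
Qed.

Let cindep_bound : exists k, forall I, cindep I -> I #<= `I_k.
Proof. by exists k => I [iI Ik _]; rewrite (ncard_leI _ (indep_finite iI)). Qed.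

(* Truncation of [M] to rank [k] in which moreover each member of [F] has rank
   less than [k]. *)
Definition collapse : matroid U :=
  Matroid cindep_ground cindep0 cindep_subset cindep_aug cindep_bound.

Lemma collapse_indepE I : indep collapse I <-> [/\ indep M I, ncard I <= k &
  forall Z, F Z -> I `<=` Z -> ncard I < k].
Proof. by []. Qed.

End Collapse.

(** * Direct sum of a matroid with the free matroid on a finite set *)

Section FreeExtension.
Variables (T W : Type) (M : matroid T) (S : set W).
Hypothesis finS : finite_set S.

Let findep : set (set (T + W)) :=
  [set I | indep M (lpart I) /\ rpart I `<=` S].

Let findep_finite I : findep I -> finite_set I.
Proof.
move=> [iI IS]; rewrite -(sumset_parts I); apply: finite_sumset.
  exact: indep_finite iI.
exact: sub_finite_set finS.
Qed.

Let findep_ground I : findep I -> I `<=` sumset (ground M) S.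
Proof. by move=> [iI IS] [t /(indep_ground iI)|w /IS]. Qed.

Let findep0 : findep set0.
Proof. by split=> //; exact: indep0. Qed.

Let findep_subset I J : I `<=` J -> findep J -> findep I.
Proof.
move=> IJ [iJ JS]; split; first by apply: indep_subset iJ => x /IJ.
by move=> x /IJ /JS.
Qed.

Let findep_aug I J : findep I -> findep J -> ~~ (J #<= I) ->
  exists x, [/\ J x, ~ I x & findep (x |` I)].
Proof.
move=> fiI fiJ; have fI := findep_finite fiI; have fJ := findep_finite fiJ.
case: (fiI) (fiJ) => iI IS [iJ JS]; rewrite ncard_le// -ltnNge.
rewrite !ncard_parts// => JI.
have [IJl|JIl] := ltnP (ncard (lpart I)) (ncard (lpart J)).
  have [t [Jt It itI]] := indep_ncard_aug iI iJ IJl.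
  by exists (inl t); split=> //; split; [rewrite lpartU1l|move=> w [//|/IS]].
(* Here the surplus of [J] lies among the new points, and any point of [S] can be added freely. *)
have [w [Jw Iw]] : exists w, J (inr w) /\ ~ I (inr w).
  apply: contrapT => nw.
  have /ncardS/(_ (finite_rpart fI)) : rpart J `<=` rpart I.
    by move=> w Jw; apply: contrapT => Iw; apply: nw; exists w.
  by lia.
exists (inr w); split=> //; split; first by rewrite lpartU1r.
by move=> v [[->]|/IS//]; exact: JS.
Qed.

Let findep_bound : exists k, forall I, findep I -> I #<= `I_k.
Proof.
exists (rank M (ground M) + ncard S) => I fiI; have fI := findep_finite fiI.
rewrite ncard_leI// ncard_parts//; case: fiI => iI IS; apply: leq_add.
  by apply: rank_ge => //; exact: indep_ground.
exact: ncardS.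
Qed.

Definition free_extension : matroid (T + W) :=
  Matroid findep_ground findep0 findep_subset findep_aug findep_bound.

End FreeExtension.

(** * Extensions of [M] constrained by two disjoint hyperplanes *)

Section Extension.
Variables (T W : Type) (M : matroid T) (r k : nat) (G1 G2 : set T).
Variables (S : set W) (F : set (set W)).

(* The independent sets of the rank-[k] extension of [M] by [S], as free as
   possible subject to [G1] and [G2], together with any [Q] in [F], having rank
   less than [k]. *)
Definition extension_indep : set (set (T + W)) := [set I |
  [/\ indep M (lpart I), rpart I `<=` S, ncard I <= k &
    forall G Q, G = G1 \/ G = G2 -> F Q -> I `<=` sumset G Q -> ncard I < k]].

Hypothesis rM : rank M (ground M) = r.
Hypothesis hG1 : hyperplane M G1.
Hypothesis hG2 : hyperplane M G2.
Hypothesis G12 : G1 `&` G2 = set0.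
Hypothesis r_le_k : r <= k.
Hypothesis finS : finite_set S.
Hypothesis F_small : forall Q, F Q -> (ncard Q).+1 < k.
Hypothesis F_sub : forall Q, F Q -> Q `<=` S.
(** For disjoint [Q] and [Q'], the flats [G + Q] and [G + Q'] meet in [G], of rank [r - 1]; this is
    at most [k - 2] exactly when [r < k]. *)
Hypothesis F_disj : forall Q Q', F Q -> F Q' -> Q <> Q' ->
  Q `&` Q' = set0 /\ r < k.

Let hyp G : (G = G1 \/ G = G2) -> hyperplane M G.
Proof. by case=> ->. Qed.

Let hyp_rank G : hyperplane M G -> (rank M G).+1 = r.
Proof. by case=> _; rewrite rM. Qed.

(** This is [collapse] applied to the free extension, the lowered flats being the sets [G + Q]. *)
Lemma hyperplane_extension : exists N : matroid (T + W),
  ground N = sumset (ground M) S /\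
  forall I, indep N I <-> extension_indep I.
Proof.
have k0 : 0 < k by have := hyp_rank hG1; lia.
pose Zs := [set Z | exists G Q, [/\ G = G1 \/ G = G2, F Q & Z = sumset G Q]].
have closed Z I x : Zs Z -> I `<=` Z -> indep (free_extension M finS) I ->
    ground (free_extension M finS) x -> ~ Z x ->
    indep (free_extension M finS) (x |` I).
  move=> [G [Q [GG FQ ->]]] IZ [iI IS] gx Zx.
  have [fG _] := hyp GG.
  have IG : lpart I `<=` G by move=> t /IZ.
  case: x gx Zx => [t|w] gx Zx; split.
  - by rewrite lpartU1l; exact: flat_indepU1 fG IG iI gx Zx.
  - by move=> w [//|/IS].
  - by rewrite lpartU1r.
  - by move=> v [[->]|/IS].
have meet Z Z' I : Zs Z -> Zs Z' -> Z <> Z' -> I `<=` Z -> I `<=` Z' ->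
    indep (free_extension M finS) I -> (ncard I).+1 < k.
  move=> [G [Q [GG FQ ->]]] [G' [Q' [GG' FQ' ->]]] ZZ' IZ IZ' iI.
  have fI := indep_finite iI; case: iI => iI IS.
  have IG : lpart I `<=` G by move=> t /IZ.
  have IG' : lpart I `<=` G' by move=> t /IZ'.
  have IQ : rpart I `<=` Q by move=> t /IZ.
  have IQ' : rpart I `<=` Q' by move=> t /IZ'.
  rewrite ncard_parts//.
  (* With a common hyperplane, [I] has no new points and lies in [G]. With two distinct ones, it has
     no old points and lies in [Q], which has at most [k - 2] elements. *)
  have [GE|GN] := pselect (G = G').
    have QN : Q <> Q' by move=> QE; apply: ZZ'; rewrite GE QE.
    have [QQ' rltk] := F_disj FQ FQ' QN.
    have -> : rpart I = set0.
      by rewrite -subset0 -QQ' => w Iw; split; [exact: IQ|exact: IQ'].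
    rewrite ncard0 addn0.
    by have := rank_ge IG iI; have := hyp_rank (hyp GG); lia.
  have -> : lpart I = set0.
    rewrite -subset0 -G12 => t It; have := IG t It; have := IG' t It.
    by case: GG GG' GN => [->|->] [->|->].
  have := ncardS IQ (sub_finite_set (F_sub FQ) finS).
  by rewrite ncard0; have := F_small FQ; lia.
exists (collapse k0 closed meet); split=> // I; rewrite collapse_indepE.
split=> [[[iI IS] Ik IF]|[iI IS Ik IF]]; split=> //.
- by move=> G Q GG FQ; apply: IF; exists G, Q.
- by move=> _ [G [Q [GG FQ ->]]]; exact: IF.
Qed.

(** Without new points nothing is lost: independent sets of [M] have at most [r <= k] elements, and
    those inside [G1] or [G2] at most [r - 1 < k]. *)
Lemma hyperplane_extension_restr N I :
  (forall I, indep N I <-> extension_indep I) ->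
  I `<=` sumset (ground M) set0 -> indep N I <-> indep M (lpart I).
Proof.
move=> NE IM; rewrite NE; split=> [[]//|iI].
have I0 : rpart I = set0 by rewrite -subset0 => w /IM.
have nI : ncard I = ncard (lpart I).
  rewrite -[in LHS](sumset_parts I) I0 ncard_sumset ?ncard0 ?addn0//.
  exact: indep_finite iI.
rewrite /extension_indep /= I0 nI; split=> //.
  apply: leq_trans r_le_k; rewrite -rM.
  by apply: rank_ge => //; exact: indep_ground.
move=> G Q GG FQ IGQ.
have := rank_ge (X := G) _ iI => /(_ (fun t It => IGQ _ It)).
by have := hyp_rank (hyp GG); lia.
Qed.

End Extension.

(** * Recognizing a copy of [M] inside the disjoint sum *)

Section Isomorphic.
Variables (T W : Type) (M : matroid T) (R : matroid (T + W)).

Lemma isomorphic_lpart : ground R = sumset (ground M) set0 ->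
  (forall I, I `<=` ground R -> indep R I <-> indep M (lpart I)) ->
  isomorphic R M.
Proof.
move=> gR iR.
(* Choice yields maps in both directions; compatibility with [inl] makes them mutually inverse. *)
have /choice[f fE] (u : ground R) : exists t : ground M, inl (val t) = val u.
  have : ground R (val u) by exact: set_valP.
  move: (val u) => v; rewrite gR; case: v => [t Mt|//].
  by exists (exist _ t (mem_set Mt)).
have /choice[g gE] (t : ground M) : exists u : ground R, val u = inl (val t).
  have Rt : ground R (inl (val t)) by rewrite gR; exact: set_valP.
  by exists (exist _ (inl (val t)) (mem_set Rt)).
exists f.
  exists g => [u|t]; apply: val_inj; first by rewrite gE fE.
  by have := fE (g t); rewrite gE => -[].
move=> I; rewrite iR; last by move=> _ [u _ <-]; exact: set_valP.
suff -> : lpart (val @` I) = val @` (f @` I) by [].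
apply/seteqP; split => [t [u Iu ut]|_ [_ [u Iu <-] <-]].
- by exists (f u); [exists u|have := fE u; rewrite ut => -[]].
- by exists u => //; rewrite fE.
Qed.

End Isomorphic.

(** * Finite sets of new points, kept disjoint by tags *)

Section Layer.
Variable C : Type.

Definition layer (c : C) (n : nat) : set (C * nat) := pair c @` `I_n.

Lemma finite_layer c n : finite_set (layer c n).
Proof. by apply: finite_image; exact: finite_II. Qed.

Lemma ncard_layer c n : ncard (layer c n) = n.
Proof.
have pair_inj : injective (@pair C nat c) by move=> ? ? [].
by rewrite (ncard_image pair_inj (finite_II n)); exact: ncard_eq (card_eqxx _).
Qed.

Lemma layer_disj c d m n : c <> d -> layer c m `&` layer d n = set0.
Proof.
by move=> cd; apply/disjoints_subset => _ [i _ <-] [j _ [dc _]]; apply: cd.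
Qed.

End Layer.

(** * Independence and rank under restriction *)

Section Amalgam.
Variable U : Type.
Implicit Types N A : matroid U.

Lemma indep_restriction A N I : restriction A (ground N) = N ->
  I `<=` ground N -> indep A I <-> indep N I.
Proof.
move=> AN IN; have -> : indep N I = (indep A I /\ I `<=` ground N).
  by rewrite -[in LHS]AN.
by split=> [|[]].
Qed.

Lemma rank_restriction A N X : restriction A (ground N) = N ->
  X `<=` ground N -> rank A X = rank N X.
Proof.
move=> AN XN; apply/eqP; rewrite eqn_leq; apply/andP; split.
  apply: rank_le => I IX iI; apply: rank_ge => //.
  by apply/(indep_restriction AN) => //; exact: subset_trans XN.
apply: rank_le => I IX iI; apply: rank_ge => //.
by apply/(indep_restriction AN) => //; exact: subset_trans XN.
Qed.

End Amalgam.

(** * Rank estimates that exclude an amalgam *)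

Section NoAmalgam.
Variables (T W : Type) (M : matroid T) (r : nat) (G1 G2 : set T).
Variables P A B : set W.
Hypothesis r3 : 3 <= r.
Hypothesis rM : rank M (ground M) = r.
Hypothesis hG1 : hyperplane M G1.
Hypothesis hG2 : hyperplane M G2.
Hypothesis G12 : G1 `&` G2 = set0.
Hypotheses (finP : finite_set P) (finA : finite_set A) (finB : finite_set B).
Hypotheses (cardP : ncard P = r - 2).
Hypotheses (cardA : ncard A = r - 1) (cardB : ncard B = r - 1).
Hypothesis AB : A `&` B = set0.

Variables N N' : matroid (T + W).
Hypothesis gN : ground N = sumset (ground M) P.
Hypothesis iN : forall I, indep N I <-> extension_indep M r G1 G2 P [set P] I.
Hypothesis gN' : ground N' = sumset (ground M) (A `|` B).
Hypothesis iN' : forall I,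
  indep N' I <-> extension_indep M r.+1 G1 G2 (A `|` B) [set A; B] I.

Let rG1 : (rank M G1).+1 = r. Proof. by case: hG1 => _ ->. Qed.
Let rG2 : (rank M G2).+1 = r. Proof. by case: hG2 => _ ->. Qed.
Let hyp_sub G : G = G1 \/ G = G2 -> G `<=` ground M.
Proof. by case: hG1 hG2 => [[? _] _] [[? _] _] [->|->]. Qed.
Let Q_sub Q : [set A; B] Q -> Q `<=` A `|` B.
Proof. by move=> [->|->] w; [left|right]. Qed.

(** [G + P] is one of the lowered flats of [N]. *)
Lemma rank_hyperplane_apex G : G = G1 \/ G = G2 -> rank N (sumset G P) < r.
Proof.
move=> GG; have [I [IGP iI <-]] := rank_basis N (sumset G P).
by case/iN: iI => _ _ _ /(_ G P GG erefl IGP).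
Qed.

(** A basis of [G] in [M] has only [r - 1] elements, so it stays independent in [N]. *)
Lemma rank_hyperplane_left G : G = G1 \/ G = G2 ->
  r.-1 <= rank N (sumset G set0).
Proof.
move=> GG; have [I [IG iI Ir]] := rank_basis M G.
have {}Ir : (ncard I).+1 = r by rewrite Ir; case: GG => ->.
have nI : ncard (@sumset T W I set0) = ncard I.
  rewrite ncard_sumset ?ncard0 ?addn0//; exact: indep_finite iI.
suff iI0 : indep N (sumset I set0).
  by have := rank_ge (sumsetS IG (@subset_refl _ set0)) iI0; rewrite nI; lia.
by apply/iN; rewrite /extension_indep /= nI; split=> //; lia.
Qed.

Lemma rank_apex : r - 2 <= rank N (sumset set0 P).
Proof.
have nP : ncard (@sumset T W set0 P) = r - 2 by rewrite ncard_sumset ?ncard0.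
rewrite -nP; apply: rank_ge => //; apply/iN; rewrite /extension_indep /= nP.
split=> //; [exact: indep0|lia|lia].
Qed.

Lemma rank_hyperplane_side G Q : G = G1 \/ G = G2 -> [set A; B] Q ->
  rank N' (sumset G Q) <= r.
Proof.
move=> GG QQ; have [I [IGQ iI <-]] := rank_basis N' (sumset G Q).
by case/iN': iI => _ _ _ /(_ G Q GG QQ IGQ).
Qed.

(** A basis of [G1], one point of [G2] and one point of [Q] form an independent set of size
    [r + 1]. *)
Lemma rank_hyperplanes_side Q : [set A; B] Q ->
  r < rank N' (sumset (G1 `|` G2) Q).
Proof.
move=> QQ; have [I [IG iI Ir]] := rank_basis M G1.
have fI := indep_finite iI.
have [J [JG _ Jr]] := rank_basis M G2.
have [t Jt] : J !=set0 by apply: ncard_gt0; lia.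
have [s Is] : I !=set0 by apply: ncard_gt0; lia.
have cQ : ncard Q = r - 1 by case: QQ => ->.
have [w Qw] : Q !=set0 by apply: ncard_gt0; lia.
have G1t : ~ G1 t.
  by move=> G1t; suff : set0 t by []; rewrite -G12; split=> //; exact: JG.
have G2s : ~ G2 s.
  by move=> G2s; suff : set0 s by []; rewrite -G12; split=> //; exact: IG.
have fw := finite_set1 w.
have ftI : finite_set (t |` I).
  by rewrite finite_setU; split=> //; exact: finite_set1.
have nK : ncard (sumset (t |` I) [set w]) = r.+1.
  rewrite ncard_sumset// ncardU1//; last by move=> /IG.
  by rewrite -(setU0 [set w]) ncardU1// ncard0 Ir; lia.
rewrite -nK; apply: rank_ge.
  by apply: sumsetS => [x [->|/IG]|x ->//]; [right; exact: JG|left].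
apply/iN'; rewrite /extension_indep /= nK; split=> //.
- have [fl _] := hG1.
  apply: (flat_indepU1 fl) => //.
  by apply: (hyp_sub (or_intror erefl)); exact: JG.
- by move=> x ->; exact: Q_sub QQ _ Qw.
(* The point [t] excludes the lowered flats through [G1], and [s] those through [G2]. *)
- move=> G Q' [->|->] _ KG; exfalso.
    by apply: G1t; apply: (KG (inl t)); left.
  by apply: G2s; apply: (KG (inl s)); right.
Qed.

Lemma rank_sides : r < rank N' (sumset set0 (A `|` B)).
Proof.
(* Two points of [B] complete the [r - 1] points of [A] to [r + 1]; they exist because [r >= 3]. The
   result lies in neither [G + A] nor [G + B]. *)
have [|C [CB fC nC]] := @ncard_subset _ B 2 finB; first by lia.
have AC : A `&` C = set0 by rewrite -subset0 -AB => w [Aw /CB].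
have [a Aa] : A !=set0 by apply: ncard_gt0; lia.
have [c Cc] : C !=set0 by apply: ncard_gt0; lia.
have Ba : ~ B a by move=> Ba; suff : set0 a by []; rewrite -AB.
have Ac : ~ A c by move=> Ac; suff : set0 c by []; rewrite -AC.
have nK : ncard (@sumset T W set0 (A `|` C)) = r.+1.
  rewrite ncard_sumset ?ncard0//; last by rewrite finite_setU.
  by have := ncardUI finA fC; rewrite AC ncard0; lia.
rewrite -nK; apply: rank_ge.
  by apply: sumsetS => // w [|/CB]; [left|right].
apply/iN'; rewrite /extension_indep /= nK; split=> //; first exact: indep0.
  by move=> w [|/CB]; [left|right].
move=> G Q _ [->|->] KG; exfalso.
  by apply: Ac; apply: (KG (inr c)); right.
by apply: Ba; apply: (KG (inr a)); left.
Qed.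

Section Contradiction.
Variable D : matroid (T + W).
Hypothesis DN : restriction D (ground N) = N.
Hypothesis DN' : restriction D (ground N') = N'.

Let rankN X Y : X `<=` ground M -> Y `<=` P ->
  rank D (sumset X Y) = rank N (sumset X Y).
Proof.
by move=> XM YP; apply: rank_restriction => //; rewrite gN; exact: sumsetS.
Qed.

Let rankN' X Y : X `<=` ground M -> Y `<=` A `|` B ->
  rank D (sumset X Y) = rank N' (sumset X Y).
Proof.
by move=> XM YP; apply: rank_restriction => //; rewrite gN'; exact: sumsetS.
Qed.

(** Submodularity for [G + Q] and [G + P], of ranks at most [r] and [r - 1], whose intersection
    contains [G], of rank at least [r - 1]. *)
Lemma rank_hyperplane_side_apex G Q : G = G1 \/ G = G2 -> [set A; B] Q ->
  rank D (sumset G (Q `|` P)) <= r.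
Proof.
move=> GG QQ; have GM := hyp_sub GG.
have := rank_submod D (sumset G Q) (sumset G P).
rewrite sumsetU sumsetI setUid setIid.
rewrite (rankN' GM (Q_sub QQ)) (rankN GM (@subset_refl _ P)).
have : rank D (sumset G set0) <= rank D (sumset G (Q `&` P)).
  by apply: rankS; apply: sumsetS.
rewrite (rankN GM (@sub0set _ P)).
have := rank_hyperplane_left GG; have := rank_hyperplane_apex GG.
have := rank_hyperplane_side GG QQ.
lia.
Qed.

(** As [G1] and [G2] are disjoint, [G1 + Q + P] and [G2 + Q + P] meet in just [Q + P], of rank at
    most [2r - (r + 1)]. *)
Lemma rank_side_apex Q : [set A; B] Q -> rank D (sumset set0 (Q `|` P)) < r.
Proof.
move=> QQ; have := rank_submod D (sumset G1 (Q `|` P)) (sumset G2 (Q `|` P)).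
rewrite sumsetU sumsetI setUid setIid G12.
have := rank_hyperplane_side_apex (or_introl erefl) QQ.
have := rank_hyperplane_side_apex (or_intror erefl) QQ.
have : rank D (sumset (G1 `|` G2) Q) <= rank D (sumset (G1 `|` G2) (Q `|` P)).
  by apply: rankS; apply: sumsetS => // w; left.
have GM : G1 `|` G2 `<=` ground M by move=> t [|]; apply: hyp_sub; [left|right].
rewrite (rankN' GM (Q_sub QQ)); have := rank_hyperplanes_side QQ; lia.
Qed.

Lemma amalgam_absurd : False.
Proof.
(* The union has rank at least [r + 1] and the intersection at least [r - 2], but the two ranks on
   the right add up to at most [2r - 2]. *)
have := rank_submod D (sumset set0 (A `|` P)) (sumset set0 (B `|` P)).
rewrite sumsetU sumsetI setUid setIid.
have := rank_side_apex (or_introl erefl).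
have := rank_side_apex (or_intror erefl).
have : rank D (sumset set0 (A `|` B)) <=
       rank D (sumset set0 ((A `|` P) `|` (B `|` P))).
  by apply: rankS; apply: sumsetS => // w [|]; [left; left|right; left].
have : rank D (sumset set0 P) <= rank D (sumset set0 ((A `|` P) `&` (B `|` P))).
  by apply: rankS; apply: sumsetS => // w; split; right.
rewrite (rankN (@sub0set _ _) (@subset_refl _ P)).
rewrite (rankN' (@sub0set _ _) (@subset_refl _ _)).
have := rank_apex; have := rank_sides.
lia.
Qed.

End Contradiction.

End NoAmalgam.

Theorem theorem3p1 (r : nat) (hr : 3 <= r) (T : Type) (M : matroid T)
    (hM : rank M (ground M) = r) (H H' : set T)
    (hH : hyperplane M H) (hH' : hyperplane M H') (hHH' : H `&` H' = set0) :
  ~ sticky M.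
Proof.
(* Distinct tags make the ground sets of [N] and [N'] overlap exactly in the copy of [M]. *)
pose P := layer 0 (r - 2); pose A := layer 1 (r - 1); pose B := layer 2 (r - 1).
have fP : finite_set P by exact: finite_layer.
have fA : finite_set A by exact: finite_layer.
have fB : finite_set B by exact: finite_layer.
have nP : ncard P = r - 2 by exact: ncard_layer.
have nA : ncard A = r - 1 by exact: ncard_layer.
have nB : ncard B = r - 1 by exact: ncard_layer.
have AB : A `&` B = set0 by exact: layer_disj.
have PAB : P `&` (A `|` B) = set0 by rewrite setIUr !layer_disj// setU0.
have fAB : finite_set (A `|` B) by rewrite finite_setU.
have smallN Q : [set P] Q -> (ncard Q).+1 < r by move=> ->; lia.
have subN Q : [set P] Q -> Q `<=` P by move=> ->.
(* Vacuous, since the family has one member; this is what allows [k = r] for [N]. *)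
have disjN Q Q' : [set P] Q -> [set P] Q' -> Q <> Q' ->
    Q `&` Q' = set0 /\ r < r.
  by move=> -> ->.
have smallN' Q : [set A; B] Q -> (ncard Q).+1 < r.+1 by move=> [] ->; lia.
have subN' Q : [set A; B] Q -> Q `<=` A `|` B by move=> [] -> w; [left|right].
have disjN' Q Q' : [set A; B] Q -> [set A; B] Q' -> Q <> Q' ->
    Q `&` Q' = set0 /\ r < r.+1.
  by move=> [] -> [] -> // _; split; rewrite // setIC.
have [N [gN iN]] := hyperplane_extension hM hH hH' hHH' (leqnn r) fP smallN
  subN disjN.
have [N' [gN' iN']] := hyperplane_extension hM hH hH' hHH' (leqnSn r)
  fAB smallN' subN' disjN'.
have restrN I : I `<=` sumset (ground M) set0 ->
    indep N I <-> indep M (lpart I).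
  exact: (hyperplane_extension_restr hM hH hH' (leqnn r) iN).
have restrN' I : I `<=` sumset (ground M) set0 ->
    indep N' I <-> indep M (lpart I).
  exact: (hyperplane_extension_restr hM hH hH' (leqnSn r) iN').
have gX : ground N `&` ground N' = sumset (ground M) set0.
  by rewrite gN gN' sumsetI setIid PAB.
have gNX : ground N `&` sumset (ground M) set0 = sumset (ground M) set0.
  by rewrite gN sumsetI setIid setI0.
have gNX' : ground N' `&` sumset (ground M) set0 = sumset (ground M) set0.
  by rewrite gN' sumsetI setIid setI0.
move=> /(_ _ N N') /=; rewrite gX; case.
(* On sets without new points, independence in [N] and in [N'] both reduce to independence in
   [M]. *)
- apply: matroid_ext => /=; first by rewrite gNX gNX'.
  by apply/seteqP; split=> I [iI IX]; split=> //;
    [apply/restrN'|apply/restrN] => //; [apply/restrN|apply/restrN'].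
- apply: isomorphic_lpart => /=; first exact: gNX.
  move=> I; rewrite gNX => IX; rewrite -restrN//.
  by split=> [[]|].
move=> D [_ DN DN'].
exact: (amalgam_absurd hr hM hH hH' hHH' fP fA fB nP nA nB AB
  gN iN gN' iN' DN DN').
Qed.
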